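(* Let $\phi\in\Phi\cup\Psi$, and let $T$ be a linear transform on $\mathbb{R}^n$ with determinant $\pm1$. For any $P\in\mathcal{M}^+$ with density $p$, $$\widetilde{\Omega}_\phi^{orlicz}(P\circ T)=\widetilde{\Omega}_\phi^{orlicz}(P)\qquad\text{and}\qquad \widetilde{G}_\phi^{orlicz}(P\circ T)=\widetilde{G}_\phi^{orlicz}(P),$$ where $P\circ T\in\mathcal{M}^+$ is the measure with density function $(p\circ T)(x)=p(Tx)$, $x\in\mathbb{R}^n$.
   Context: The underlying space is $\mathbb{R}^n$ with Lebesgue measure; for a nonnegative measurable function $p$ write $\mu(p)=\int_{\mathbb{R}^n}p(x)\,dx$. $\mathcal{F}^+$ is the set of positive real-valued measurable functions on $\mathbb{R}^n$, and $\mathcal{M}^+$ is the set of finite measures on $\mathbb{R}^n$ having a density (with respect to Lebesgue measure) in $\mathcal{F}^+$. Let $\gamma_n(x)=e^{-\|x\|_2^2/2}$ with $\|\cdot\|_2$ the Euclidean norm. For $p\in\mathcal{F}^+$, its polar dual function is $p^\circ(y)=\inf_{x\in\mathbb{R}^n}\frac{e^{-\langle x,y\rangle}}{p(x)}$. Let $\mathcal{D}=\{p\in\mathcal{F}^+:\mu(p)\mu(p^\circ)\le[\mu(\gamma_n)]^2\}$, where $\mu(\gamma_n)^2=(2\pi)^n$, and let $\mathcal{L}_c$ be the set of log-concave functions on $\mathbb{R}^n$ (functions of the form $e^{-\psi}$ with $\psi$ convex). Writing $Q\in\mathcal{D}$ (resp. $Q\in\mathcal{D}\cap\mathcal{L}_c$)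 for a finite measure $Q$ means that its density $q$ belongs to $\mathcal{D}$ (resp. $\mathcal{D}\cap\mathcal{L}_c$). $\Phi$ is the set of functions $\phi:(0,\infty)\to(0,\infty)$ that are decreasing and strictly convex; $\Psi$ is the set of functions $\phi:(0,\infty)\to(0,\infty)$ that are increasing and strictly concave. For measures $P,Q$ with densities $p,q$ and a constant $a\ge 0$, $D_\phi(aQ,P)=\int_{\mathbb{R}^n}\phi\left(\frac{a\,q(x)}{p(x)}\right)p(x)\,dx$, with the convention $\phi(0)=\lim_{t\to0^+}\phi(t)\in[0,\infty]$. For $P\in\mathcal{M}^+$ the dual functional Orlicz affine surface area is $$\widetilde{\Omega}_\phi^{orlicz}(P)=\inf_{Q\in\mathcal{D}}D_\phi\left(\frac{\mu(q^\circ)}{\mu(\gamma_n)}Q,P\right)\ \text{ if }\phi\in\Phi,$$ and it is defined by the same formula with $\inf$ replaced by $\sup$ if $\phi\in\Psi$. The dual functional Orlicz geominimal surface area $\widetilde{G}_\phi^{orlicz}(P)$ is defined in the same way with $\mathcal{D}$ replaced by $\mathcal{D}\cap\mathcal{L}_c$. *)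

(* Defs.v *)
From HB Require Import structures.
From mathcomp Require Import all_boot all_order all_algebra.
From mathcomp Require Import all_classical all_reals all_analysis.

Set Implicit Arguments.
Unset Strict Implicit.
Unset Printing Implicit Defensive.
Import Order.TTheory GRing.Theory Num.Theory.
Import numFieldNormedType.Exports.
Local Open Scope classical_set_scope.
Local Open Scope ring_scope.

(** * Lebesgue measure on R^n, carried by row vectors *)

Section borel_rV.
Variables (R : realType) (n : nat).

Definition rV_cylinders : set (set 'rV[R]_n) :=
  [set [set v : 'rV[R]_n | A (v ord0 i)] |
    i in [set: 'I_n] & A in (@measurable _ (measurableTypeR R))].

(** The sigma-algebra generated by the coordinate maps, i.e. the Borel one. *)
Definition borel_rV := g_sigma_algebraType rV_cylinders.
HB.instance Definition _ := Measurable.on borel_rV.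

Lemma measurable_coord_rV (i : 'I_n) :
  measurable_fun [set: borel_rV]
    (fun v : borel_rV => (v : 'rV[R]_n) ord0 i : measurableTypeR R).
Proof.
by move=> _ A mA; rewrite setTI; apply: sub_sigma_algebra; exists i => //; exists A.
Qed.

Lemma measurable_fun_rV d (T : measurableType d) (f : T -> borel_rV) :
  (forall i, measurable_fun [set: T]
    (fun t => (f t : 'rV[R]_n) ord0 i : measurableTypeR R)) ->
  measurable_fun [set: T] f.
Proof.
move=> mf; apply: (@measurability _ _ _ _ _ f rV_cylinders) => //.
by move=> _ [_ [i _ [A mA <-]] <-]; exact: mf.
Qed.

End borel_rV.

Section rV_cons.
Variables (R : realType) (n : nat).
Local Notation R1 := (measurableTypeR R).

Definition rV_cons (t : R1 * borel_rV R n) : borel_rV R n.+1 :=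
  row_mx (t.1 : R)%:M (t.2 : 'rV[R]_n) : 'rV[R]_(1 + n).

Definition rV_uncons (v : borel_rV R n.+1) : R1 * borel_rV R n :=
  ((v : 'rV[R]_(1 + n)) ord0 ord0 : R, rsubmx (v : 'rV[R]_(1 + n))).

Lemma rV_consK : cancel rV_cons rV_uncons.
Proof.
move=> [x v]; rewrite /rV_cons /rV_uncons /= row_mxKr; congr pair.
have <- : lshift n ord0 = ord0 :> 'I_(1 + n) by exact: val_inj.
by rewrite row_mxEl mxE eqxx mulr1n.
Qed.

Lemma measurable_rV_cons : measurable_fun [set: R1 * borel_rV R n] rV_cons.
Proof.
apply: measurable_fun_rV => i.
case: (split_ordP (i : 'I_(1 + n))) => [j ij|j ij].
  rewrite (_ : (fun _ => _) = fst); first exact: measurable_fst.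
  apply/funext => t; rewrite /rV_cons.
  have -> : i = lshift n j := ij.
  apply: (etrans (row_mxEl _ _ _ _)); by rewrite mxE (ord1 j) eqxx mulr1n.
rewrite (_ : (fun _ => _) =
  (fun v : borel_rV R n => (v : 'rV[R]_n) ord0 j : R1) \o snd).
  by apply: measurableT_comp; [exact: measurable_coord_rV|exact: measurable_snd].
apply/funext => t; rewrite /rV_cons.
have -> : i = rshift 1 j := ij.
exact: (etrans (row_mxEr _ _ _ _)).
Qed.

Lemma measurable_rV_uncons : measurable_fun [set: borel_rV R n.+1] rV_uncons.
Proof.
apply/measurable_fun_pairP; split.
  exact: (@measurable_coord_rV R n.+1 ord0).
apply: measurable_fun_rV => i.
rewrite (_ : (fun _ => _) = (fun v : borel_rV R n.+1 =>
  (v : 'rV[R]_n.+1) ord0 (rshift 1 i : 'I_n.+1) : R1)).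
  exact: measurable_coord_rV.
by apply/funext => v /=; rewrite !mxE.
Qed.

Variable m : {sigma_finite_measure set (borel_rV R n) -> \bar R}.

Definition volumeS : set (borel_rV R n.+1) -> \bar R :=
  pushforward (@lebesgue_measure R \x m)%E rV_cons.

Let volumeS0 : volumeS set0 = 0%E.
Proof. by rewrite /volumeS /pushforward preimage_set0 measure0. Qed.

Let volumeS_ge0 A : (0 <= volumeS A)%E.
Proof. by rewrite /volumeS /pushforward; exact: measure_ge0. Qed.

Let volumeS_sigma_additive : semi_sigma_additive volumeS.
Proof.
have mcons A : measurable A -> measurable (rV_cons @^-1` A).
  by move=> mA; rewrite -[X in measurable X]setTI; exact: measurable_rV_cons.
move=> F mF tF mUF; rewrite /volumeS /pushforward preimage_bigcup.
apply: measure_semi_sigma_additive => [k||]; first exact: mcons.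
- apply/trivIsetP => /= i j _ _ ij; rewrite -preimage_setI.
  by move/trivIsetP : tF => /(_ _ _ _ _ ij) ->//; rewrite preimage_set0.
- by rewrite -preimage_bigcup; exact: mcons.
Qed.

HB.instance Definition _ := isMeasure.Build _ _ _ volumeS
  volumeS0 volumeS_ge0 volumeS_sigma_additive.

Let volumeS_sigma_finite : sigma_finite setT volumeS.
Proof.
have /sigma_finiteP[F [FT ndF Foo]] := sigma_finiteT (@lebesgue_measure R).
have /sigma_finiteP[G [GT ndG Goo]] := sigma_finiteT m.
exists (fun k => rV_uncons @^-1` (F k `*` G k)).
  rewrite -preimage_bigcup (_ : \bigcup_k _ = setT) ?preimage_setT//.
  rewrite -subTset => -[x v] _.
  have [k _ Fkx] : (\bigcup_k F k) x by rewrite -FT.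
  have [l _ Glv] : (\bigcup_k G k) v by rewrite -GT.
  exists (maxn k l) => //; split.
  - by move: x Fkx; exact/subsetPset/ndF/leq_maxl.
  - by move: v Glv; exact/subsetPset/ndG/leq_maxr.
move=> k; have [mFk Fkoo] := Foo k; have [mGk Gkoo] := Goo k; split.
  by rewrite -[X in measurable X]setTI; apply: measurable_rV_uncons => //;
    exact: measurableX.
rewrite /volumeS /pushforward (_ : _ @^-1` _ = F k `*` G k); last first.
  by rewrite -comp_preimage (_ : _ \o _ = id) ?preimage_id//;
    apply/funext => t; exact: rV_consK.
by rewrite product_measure1E// lte_mul_pinfty// ge0_fin_numE.
Qed.

HB.instance Definition _ := Measure_isSigmaFinite.Build _ _ _ volumeS
  volumeS_sigma_finite.

End rV_cons.

Fixpoint volume (R : realType) (n : nat) :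
    {sigma_finite_measure set (borel_rV R n) -> \bar R} :=
  match n with
  | 0%N => dirac ((0 : 'rV[R]_0) : borel_rV R 0)
  | n'.+1 => volumeS (volume R n')
  end.

(** [lebesgue_rV R n] is R^n with its Lebesgue-measurable sets, and
    [lebesgue R n] the Lebesgue measure, obtained by completing the [n]-fold
    product of the one-dimensional Lebesgue measure. *)
Definition lebesgue_rV (R : realType) (n : nat) :=
  caratheodory_type (volume R n)^*%mu.
HB.instance Definition _ (R : realType) (n : nat) :=
  Measurable.on (lebesgue_rV R n).

Definition lebesgue (R : realType) (n : nat) : set (lebesgue_rV R n) -> \bar R :=
  @completed_measure_extension _ _ _ (volume R n).
HB.instance Definition _ (R : realType) (n : nat) :=
  Measure.on (@lebesgue R n).

(** * Functions and measures on R^n *)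

Section functional_orlicz.
Variables (R : realType) (n : nat).
Local Notation Rn := 'rV[R]_n.
Local Notation Ln := (lebesgue_rV R n).

Definition mu (p : Rn -> R) : \bar R := (\int[@lebesgue R n]_x (p x)%:E)%E.

Definition dotp (x y : Rn) : R := \sum_(i < n) x ord0 i * y ord0 i.

Definition gamma (x : Rn) : R := expR (- (dotp x x / 2)).

Definition Fplus : set (Rn -> R) :=
  [set p | measurable_fun [set: Ln] (p : Ln -> R) /\ forall x, 0 < p x].

(** The real infimum is meaningful for [p > 0]: the set is nonempty and bounded
    below by [0]. *)
Definition polar (p : Rn -> R) (y : Rn) : R :=
  inf [set expR (- dotp x y) / p x | x in [set: Rn]].

Definition Dset : set (Rn -> R) :=
  [set p | Fplus p /\ (mu p * mu (polar p) <= mu gamma ^+ 2)%E].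

(** All the functions considered are positive, so the convex function [psi] is
    real-valued. *)
Definition log_concave : set (Rn -> R) :=
  [set p | exists2 psi : convex_lmodType Rn -> R^o,
    convex_function [set: convex_lmodType Rn] psi &
    forall x, p x = expR (- psi x)].

(** [has_density P p]: the finite measure [P] belongs to M^+, with density [p]. *)
Definition has_density (P : {finite_measure set Ln -> \bar R}) (p : Rn -> R) :=
  Fplus p /\ forall A : set Ln, measurable A ->
    P A = (\int[@lebesgue R n]_(x in A) (p x)%:E)%E.

(** * Orlicz functions: maps (0, oo) -> (0, oo), encoded as maps R -> R whose
    values outside (0, oo) are irrelevant *)

Definition strictly_convex_pos (phi : R -> R) := forall s t l : R,
  0 < s -> 0 < t -> s != t -> 0 < l < 1 ->
  phi (l * s + (1 - l) * t) < l * phi s + (1 - l) * phi t.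

Definition strictly_concave_pos (phi : R -> R) := forall s t l : R,
  0 < s -> 0 < t -> s != t -> 0 < l < 1 ->
  l * phi s + (1 - l) * phi t < phi (l * s + (1 - l) * t).

Definition Phi : set (R -> R) :=
  [set phi | [/\ forall t, 0 < t -> 0 < phi t,
    forall s t, 0 < s -> s < t -> phi t < phi s &
    strictly_convex_pos phi]].

Definition Psi : set (R -> R) :=
  [set phi | [/\ forall t, 0 < t -> 0 < phi t,
    forall s t, 0 < s -> s < t -> phi s < phi t &
    strictly_concave_pos phi]].

Lemma Phi_Psi_disjoint : Phi `&` Psi = set0.
Proof.
rewrite -subset0 => phi [[_ dec _] [_ inc _]].
have := lt_trans (dec 1 2 ltr01 (ltr1n _ 2)) (inc 1 2 ltr01 (ltr1n _ 2)).
by rewrite ltxx.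
Qed.

(** The value at [0] is the limit at [0^+], possibly [+oo]; negative arguments
    do not occur. *)
Definition phi_ext (phi : R -> R) (t : R) : \bar R :=
  if 0 < t then (phi t)%:E else lim ((phi s)%:E @[s --> 0^'+]).

Definition Dphi (phi : R -> R) (a : R) (q p : Rn -> R) : \bar R :=
  (\int[@lebesgue R n]_x (phi_ext phi (a * q x / p x) * (p x)%:E))%E.

(** The values of the divergence of [(mu q° / mu gamma) Q] and [P], for [P] in
    M^+ and [Q] in M^+ with a density [q] in [C].  The density [p] of [P] is
    determined almost everywhere, so its choice does not affect the values; the
    density [q] matters pointwise, through [polar q].  For [q] in [Dset],
    [mu (polar q)] is finite since [mu q > 0], so that [fine] loses nothing. *)
Definition divergences (phi : R -> R) (C : set (Rn -> R))
    (P : {finite_measure set Ln -> \bar R}) : set (\bar R) :=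
  [set d | exists p q (Q : {finite_measure set Ln -> \bar R}),
    [/\ has_density P p, has_density Q q, C q &
        d = Dphi phi (fine (mu (polar q)) / fine (mu gamma)) q p]].

(** By [Phi_Psi_disjoint], the second branch is taken for [phi] in [Psi]. *)
Definition orlicz_extremum (phi : R -> R) (C : set (Rn -> R))
    (P : {finite_measure set Ln -> \bar R}) : \bar R :=
  if `[< Phi phi >] then ereal_inf (divergences phi C P)
  else ereal_sup (divergences phi C P).

Definition dual_affine_surface_area (phi : R -> R) :=
  orlicz_extremum phi Dset.

Definition dual_geominimal_surface_area (phi : R -> R) :=
  orlicz_extremum phi (Dset `&` log_concave).

End functional_orlicz.

(* Main.v *)
Require Import Defs.
From HB Require Import structures.
From mathcomp Require Import all_boot all_order all_algebra.
From mathcomp Require Import all_classical all_reals all_analysis.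
From mathcomp Require Import measurable_realfun ring.

Set Implicit Arguments.
Unset Strict Implicit.
Unset Printing Implicit Defensive.
Import Order.TTheory GRing.Theory Num.Theory.
Import numFieldNormedType.Exports.
Local Open Scope classical_set_scope.
Local Open Scope ring_scope.

(** Why the theorem holds: every ingredient of the definition is equivariant
    under a linear change of variables [x |-> x *m M] with [`|\det M| = 1].

    The one analytic fact is that such a map preserves Lebesgue measure, hence
    every integral ([integral_lebesgue_mulmx]).  Granting it, substitute
    [q \o M] for [q]: the integral of [q] does not change, and since
    [<x M^-1, y> = <x, y M^-T>] the polar of [q \o M] is the polar of [q]
    composed with [M^-T], which is again unimodular, so [mu (polar q)] does not
    change either.  Hence [q |-> q \o M] maps the class [Dset] to itself, and
    also the log-concave functions, since [M] is linear.  As the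
    integrand of the divergence of [q \o M] and [p \o M] is the one of [q] and
    [p] composed with [M], each divergence value for [P] is a value for
    [P \o M] ([divergences_mulmx_sub]).  Applying this to [M^-1] gives
    the converse inclusion; the two sets of values coincide, and so do their
    infima and suprema, whichever of them [phi] calls for.

    The behaviour of the volume under linear maps ([det_scales_volume]) is
    proved along the recursive definition of the measure, by Tonelli.  If the
    upper left entry [a] of [M] is nonzero, [M] factors as
    [[a 0; d 1] * [1 e; 0 S]] with [S] the Schur complement.  The first factor
    acts on the first coordinate by an affine map of the line and fixes the
    other coordinates; the second fixes the first coordinate and acts on the
    others by an affine map with linear part [S], to which the induction
    hypothesis applies.  If [a = 0], a shear [[1 f; 0 1]] makes that entry
    nonzero.  Passing from Borel sets to the completed measure only uses that the map is a
    Borel isomorphism: it then carries covers to covers, so it preserves the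
    outer measure ([mu_ext_preimage]) and the Caratheodory sets. *)

(** * Integrals under an isomorphism of measure spaces *)

Section integral_of_measure_isomorphism.
Local Open Scope ereal_scope.

Import HBNNSimple.

(** Precomposition turns simple functions below [h] into simple functions below
    [h \o f] with the same integral.  For a non-measurable [h], [h \o f] may
    have larger simple minorants, not of this form: hence only an inequality. *)
Lemma ge0_le_integral_comp d1 d2 (X : measurableType d1) (Y : measurableType d2)
    (R : realType) (m1 : {measure set X -> \bar R})
    (m2 : {measure set Y -> \bar R}) (f : X -> Y) (h : Y -> \bar R) :
  measurable_fun [set: X] f ->
  (forall A, measurable A -> m1 (f @^-1` A) = m2 A) ->
  (forall y, 0 <= h y) ->
  \int[m2]_y h y <= \int[m1]_x h (f x).
Proof.
move=> mf fm h0; rewrite !ge0_integralTE//.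
apply: ereal_sup_le => _ /= [k kh <-].
have mkf : measurable_fun [set: X] (k \o f) by exact: measurableT_comp.
have fkf : finite_set (range (k \o f)).
  by apply: sub_finite_set (fimfunP k) => _ [x _ <-]; exists (f x).
have k0 x : (0 <= (k \o f) x)%R by [].
pose kf : {nnsfun X >-> R} := HB.pack (k \o f)
  (isMeasurableFun.Build _ _ _ _ _ mkf) (FiniteImage.Build _ _ _ fkf)
  (isNonNegFun.Build _ _ _ k0).
exists kf => [x|]; first exact: kh.
rewrite !sintegralET; apply: eq_fsbigr => r _.
by congr (_ * _); rewrite -fm// comp_preimage.
Qed.

Variables (d1 d2 : measure_display) (X : measurableType d1).
Variables (Y : measurableType d2) (R : realType).
Variables (m1 : {measure set X -> \bar R}) (m2 : {measure set Y -> \bar R}).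
Variables (f : X -> Y) (g : Y -> X).
Hypotheses (mf : measurable_fun [set: X] f) (mg : measurable_fun [set: Y] g).
Hypotheses (fK : cancel f g) (gK : cancel g f).
Hypothesis fm : forall A, measurable A -> m1 (f @^-1` A) = m2 A.

Let ge0_integral_iso (h : Y -> \bar R) : (forall y, 0 <= h y) ->
  \int[m2]_y h y = \int[m1]_x h (f x).
Proof.
move=> h0; apply/eqP; rewrite eq_le ge0_le_integral_comp//=.
have gm A : measurable A -> m2 (g @^-1` A) = m1 A.
  move=> mA; rewrite -fm; last by rewrite -[X in measurable X]setTI; exact: mg.
  by congr (m1 _); apply/funext => x; rewrite /preimage/= fK.
apply: le_trans (ge0_le_integral_comp mg gm _) _ => //.
by under eq_integral do rewrite gK.
Qed.

(** The previous inequality, used for [f] and for its inverse.  Keeping [h]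
    arbitrary lets the formula apply directly to polars, which are infima over
    uncountable families. *)
Lemma integral_measure_iso (D : set Y) (h : Y -> \bar R) :
  \int[m2]_(y in D) h y = \int[m1]_(x in f @^-1` D) h (f x).
Proof.
rewrite integral_mkcond [RHS]integral_mkcond.
have -> : (h \o f) \_ (f @^-1` D) = (h \_ D) \o f.
  by apply/funext => x; rewrite /= !patchE.
rewrite [LHS]integralE [RHS]integralE.
rewrite (ge0_integral_iso (funepos_ge0 _)).
rewrite (ge0_integral_iso (funeneg_ge0 _)).
by congr (_ - _); apply: eq_integral => x _; rewrite ?funeposE ?funenegE.
Qed.

End integral_of_measure_isomorphism.

(** * Affine maps of the line *)

Section lebesgue_measure_affine.
Variables (R : realType) (a b : R).
Local Notation R1 := (measurableTypeR R).
Local Notation aff := (fun x : R1 => a * x + b : R1).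

Lemma measurable_affine : measurable_fun [set: R1] aff.
Proof. by apply: measurable_funD => //; exact: measurable_funM. Qed.

Hypothesis a0 : a != 0.

Let affine_preimage_oc (s t : R) : aff @^-1` `]s, t] =
  if 0 < a then `](s - b) / a, (t - b) / a]%classic
  else `[(t - b) / a, (s - b) / a[%classic.
Proof.
apply/seteqP; case: ifPn => [a_gt0|].
  split => x /=; rewrite !in_itv/= ltr_pdivrMr// ler_pdivlMr// ltrBlDr;
    by rewrite lerBrDr mulrC.
rewrite -leNgt le_eqVlt (negbTE a0)/= => a_lt0.
split => x /=; rewrite !in_itv/= ltr_ndivlMr// ler_ndivrMr// ltrBlDr;
  by rewrite lerBrDr mulrC andbC.
Qed.

Lemma lebesgue_measure_affine (A : set R1) : measurable A ->
  (`|a|%:E * lebesgue_measure (aff @^-1` A))%E = lebesgue_measure A.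
Proof.
move=> mA; apply/esym.
unshelve refine (@lebesgue_measure_unique R
  (mscale (NngNum (normr_ge0 a)) (pushforward lebesgue_measure aff)) _ A mA).
  exact: measurable_affine.
move=> _ [[s t] _ <-] /=; rewrite /mscale/= /pushforward affine_preimage_oc.
case: ifPn => [a_gt0|].
  rewrite lebesgue_measure_itv/= lte_fin lebesgue_measure_itv/= lte_fin.
  rewrite ltr_pM2r ?invr_gt0// ltrD2r gtr0_norm//.
  case: ifPn => st; last by rewrite mule0.
  by rewrite -EFinB -EFinM; congr EFin; field.
rewrite -leNgt le_eqVlt (negbTE a0)/= => a_lt0.
rewrite lebesgue_measure_itv/= lte_fin lebesgue_measure_itv/= lte_fin.
rewrite ltr_nM2r ?invr_lt0// ltrD2r ltr0_norm//.
case: ifPn => st; last by rewrite mule0.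
by rewrite -EFinB -EFinM; congr EFin; field.
Qed.

End lebesgue_measure_affine.

(** * Maps of a product acting on one coordinate *)

Section fiberwise_scaling.
Local Open Scope ereal_scope.
Variables (d1 d2 : measure_display) (X : measurableType d1).
Variables (Y : measurableType d2) (R : realType).
Variables (m1 : {sigma_finite_measure set X -> \bar R}).
Variables (m2 : {sigma_finite_measure set Y -> \bar R}).
Variables (c : R) (c0 : (0 <= c)%R).

(** Tonelli for a map that moves only the second coordinate and scales the
    measure of each fibre by the same factor. *)
Lemma product_measure1_scale_snd (g : X -> Y -> Y) :
  measurable_fun [set: X * Y] (fun z => (z.1, g z.1 z.2)) ->
  (forall x B, measurable B -> c%:E * m2 (g x @^-1` B) = m2 B) ->
  forall A, measurable A ->
  c%:E * (m1 \x m2) ((fun z => (z.1, g z.1 z.2)) @^-1` A) = (m1 \x m2) A.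
Proof.
move=> mg gm A mA; have mgA : measurable ((fun z => (z.1, g z.1 z.2)) @^-1` A).
  by rewrite -[X in measurable X]setTI; exact: mg.
rewrite /product_measure1 -ge0_integralZl; last first.
- by rewrite lee_fin.
- by move=> x _; exact: measure_ge0.
- exact: measurable_fun_xsection.
- exact: measurableT.
apply: eq_integral => x _ /=.
rewrite -[RHS](gm x); last exact: measurable_xsection.
by rewrite !xsectionE.
Qed.

(** The same for the first coordinate, slicing in the other order. *)
Lemma product_measure1_scale_fst (g : Y -> X -> X) :
  measurable_fun [set: X * Y] (fun z => (g z.2 z.1, z.2)) ->
  (forall y B, measurable B -> c%:E * m1 (g y @^-1` B) = m1 B) ->
  forall A, measurable A ->
  c%:E * (m1 \x m2) ((fun z => (g z.2 z.1, z.2)) @^-1` A) = (m1 \x m2) A.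
Proof.
have pm12 A : measurable A -> (m1 \x m2) A = (m1 \x^ m2) A.
  by apply: product_measure_unique => //= B C mB mC; exact: product_measure2E.
move=> mg gm A mA; have mgA : measurable ((fun z => (g z.2 z.1, z.2)) @^-1` A).
  by rewrite -[X in measurable X]setTI; exact: mg.
rewrite !pm12// /product_measure2 -ge0_integralZl; last first.
- by rewrite lee_fin.
- by move=> y _; exact: measure_ge0.
- exact: measurable_fun_ysection.
- exact: measurableT.
apply: eq_integral => y _ /=.
rewrite -[RHS](gm y); last exact: measurable_ysection.
by rewrite !ysectionE.
Qed.

End fiberwise_scaling.

(** * The determinant as volume ratio *)

Section measurable_linear_rV.
Variable R : realType.

Lemma measurable_mulmxD d (T : measurableType d) m n (M : 'M[R]_(m, n))
    (f : T -> borel_rV R m) (g : T -> borel_rV R n) :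
  measurable_fun [set: T] f -> measurable_fun [set: T] g ->
  measurable_fun [set: T]
    (fun t => ((f t : 'rV[R]_m) *m M + (g t : 'rV[R]_n))%R : borel_rV R n).
Proof.
move=> mf mg; apply: measurable_fun_rV => i.
under eq_fun do rewrite !mxE.
apply: measurable_funD; last first.
  exact: (measurableT_comp (@measurable_coord_rV R n i) mg).
apply: measurable_sum => k; apply: measurable_funM => //.
exact: (measurableT_comp (@measurable_coord_rV R m k) mf).
Qed.

Lemma measurable_affine_rV m n (M : 'M[R]_(m, n)) (c : 'rV[R]_n) :
  measurable_fun [set: borel_rV R m]
    (fun v : borel_rV R m => (v : 'rV[R]_m) *m M + c : borel_rV R n).
Proof. exact: (@measurable_mulmxD _ _ _ _ _ id (cst c)). Qed.

End measurable_linear_rV.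

Section volume_affine.
Variable R : realType.

Definition affine_rV n (M : 'M[R]_n) (c : 'rV[R]_n) (v : borel_rV R n) :
  borel_rV R n := (v : 'rV[R]_n) *m M + c.

(** The translation part [c] is carried along because it appears in the fibres:
    over a fixed first coordinate, a linear map acts on the remaining ones
    by an affine map. *)
Definition scales_volume n (M : 'M[R]_n) (c : 'rV[R]_n) :=
  forall A : set (borel_rV R n), measurable A ->
    (`|\det M|%:E * volume R n (affine_rV M c @^-1` A))%E = volume R n A.

Lemma scales_volume_comp n (M N : 'M[R]_n) (c d : 'rV[R]_n) :
  scales_volume M c -> scales_volume N d ->
  scales_volume (M *m N) (c *m N + d).
Proof.
move=> sM sN A mA; rewrite -[RHS]sN// -[X in _ = (_ * X)%E]sM; last first.
  by rewrite -[X in measurable X]setTI; exact: measurable_affine_rV.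
rewrite muleA -EFinM -normrM mulrC -det_mulmx; congr (_ * volume R n _)%E.
by apply/funext => v; rewrite /preimage /affine_rV/= mulmxDl mulmxA addrA.
Qed.

Lemma scales_volume_block_ur n (e : 'rV[R]_n) (S : 'M[R]_n)
    (c : 'rV[R]_n) :
  (forall c', scales_volume S c') ->
  @scales_volume n.+1 (block_mx 1%:M e 0 S : 'M[R]_(1 + n))
    (row_mx 0 c : 'rV[R]_(1 + n)).
Proof.
move=> sS A mA; have detE : \det (block_mx (1%:M : 'M[R]_1) e 0 S) = \det S.
  by rewrite det_ublock det1 mul1r.
rewrite [X in `|X|]detE.
rewrite /= /volumeS /pushforward.
pose g (x : measurableTypeR R) (w : borel_rV R n) : borel_rV R n :=
  (w : 'rV[R]_n) *m S + (x *: e + c).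
rewrite -[RHS](@product_measure1_scale_snd _ _ _ _ R lebesgue_measure (volume R n)
  `|\det S| _ g)//; last 3 first.
- apply: measurable_fun_pair => //; apply: measurable_mulmxD => //.
  apply: measurable_fun_rV => i; under eq_fun do rewrite !mxE.
  by apply: measurable_funD => //; exact: measurable_funM.
- by move=> x B; exact: sS.
- by rewrite -[X in measurable X]setTI; exact: measurable_rV_cons.
have consE (x : R) (w : 'rV[R]_n) :
    row_mx (x%:M : 'M[R]_1) w *m block_mx 1%:M e 0 S + row_mx 0 c =
    row_mx x%:M (g x w).
  rewrite mul_row_block add_row_mx mulmx1 mulmx0 mul_scalar_mx !addr0.
  by rewrite /g addrCA addrA.
congr (_ * product_measure1 _ _ _)%E; apply/funext => -[x w].
by congr A; exact: consE.
Qed.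

Lemma scales_volume_block_dl n (a : R) (d : 'cV[R]_n) (b : R) : a != 0 ->
  @scales_volume n.+1 (block_mx a%:M 0 d 1%:M : 'M[R]_(1 + n))
    (row_mx b%:M 0 : 'rV[R]_(1 + n)).
Proof.
move=> a0 A mA; have detE : \det (block_mx (a%:M : 'M[R]_1) 0 d 1%:M) = a.
  by rewrite det_lblock det1 mulr1 det_scalar1.
rewrite [X in `|X|]detE.
rewrite /= /volumeS /pushforward.
pose g (w : borel_rV R n) (x : measurableTypeR R) : measurableTypeR R :=
  a * x + (((w : 'rV[R]_n) *m d) ord0 ord0 + b).
rewrite -[RHS](@product_measure1_scale_fst _ _ _ _ R lebesgue_measure (volume R n)
  `|a| _ g)//; last 3 first.
- apply: measurable_fun_pair => //; apply: measurable_funD => //=.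
    exact: measurable_funM.
  apply: measurable_funD => //; under eq_fun do rewrite !mxE.
  apply: measurable_sum => k; apply: measurable_funM => //.
  exact: (measurableT_comp (@measurable_coord_rV R n k) measurable_snd).
- by move=> y B; exact: lebesgue_measure_affine.
- by rewrite -[X in measurable X]setTI; exact: measurable_rV_cons.
have consE (x : R) (w : 'rV[R]_n) :
    row_mx (x%:M : 'M[R]_1) w *m block_mx a%:M 0 d 1%:M + row_mx b%:M 0 =
    row_mx (g w x)%:M w.
  rewrite mul_row_block add_row_mx mulmx1 mulmx0 add0r addr0 /g; congr row_mx.
  apply/matrixP => i j; rewrite !ord1 !mxE big_ord1 !mxE mulr1n addrA.
  by rewrite [x * a]mulrC.
congr (_ * product_measure1 _ _ _)%E; apply/funext => -[x w].
by congr A; exact: consE.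
Qed.

(** Induction on the dimension, eliminating the first coordinate by a block LU
    factorization. *)
Lemma det_scales_volume n (M : 'M[R]_n) (c : 'rV[R]_n) :
  M \in unitmx -> scales_volume M c.
Proof.
elim: n M c => [|n IH] M c uM.
  move=> A mA; rewrite det_mx00 normr1 mul1e; congr (volume R 0 _).
  by apply/funext => v; rewrite /preimage/=; congr A; rewrite !thinmx0.
(* A nonzero pivot [a]: [S] is its Schur complement. *)
have scales_nz (N : 'M[R]_(1 + n)) c' :
    N \in unitmx -> ulsubmx N ord0 ord0 != 0 -> scales_volume N c'.
  set a := ulsubmx N ord0 ord0 => uN a0.
  pose d := dlsubmx N; pose e := a^-1 *: ursubmx N.
  pose S := drsubmx N - d *m e.
  have NE : N = block_mx a%:M 0 d 1%:M *m block_mx 1%:M e 0 S.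
    rewrite mulmx_block !mulmx1 !mulmx0 !mul0mx !mul1mx !addr0.
    rewrite addrC subrK mul_scalar_mx scalerA divff// scale1r.
    by rewrite -[LHS]submxK [ulsubmx N]mx11_scalar.
  have uS : S \in unitmx.
    move: uN; rewrite NE !unitmxE det_mulmx det_lblock det_ublock !det1.
    by rewrite mulr1 mul1r unitrM => /andP[].
  (* The constant [c2] absorbs the image of [b] under the second factor. *)
  pose b := lsubmx c' ord0 ord0; pose c2 := rsubmx c' - b *: e.
  have cE : c' = row_mx b%:M 0 *m block_mx 1%:M e 0 S + row_mx 0 c2.
    rewrite mul_row_block add_row_mx mulmx1 !mulmx0 mul0mx !addr0 mul_scalar_mx.
    by rewrite addrC subrK -[LHS]hsubmxK [lsubmx c']mx11_scalar.
  rewrite NE cE; apply: scales_volume_comp.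
    exact: scales_volume_block_dl.
  by apply: scales_volume_block_ur => c3; exact: IH.
(* A zero pivot: the rest [d] of the first column is nonzero, and adding [d^T]
   times the lower rows to the first row makes the pivot [d^T *m d]. *)
pose N := M : 'M[R]_(1 + n).
have [a0|a0] := eqVneq (ulsubmx N ord0 ord0) 0; last exact: (scales_nz N).
pose d := dlsubmx N.
have ul0 : ulsubmx N = 0 by rewrite [LHS]mx11_scalar a0 raddf0.
have d0 : d != 0.
  apply/eqP => d0; have detN : \det N = 0.
    by rewrite -[N]submxK -/d d0 det_ublock ul0 det_mx11 mxE mul0r.
  by move: uM; rewrite unitmxE [X in X \is a _]detN unitr0.
pose E (s : R) : 'M[R]_(1 + n) := block_mx 1%:M (s *: d^T) 0 1%:M.
have uE s : E s \in unitmx by rewrite unitmxE det_ublock !det1 mulr1 unitr1.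
have NE : N = E (-1) *m (E 1 *m N).
  rewrite mulmxA mulmx_block !mulmx1 !mulmx0 !mul1mx !mul0mx !addr0 !add0r.
  by rewrite scale1r scaleN1r subrr -scalar_mx_block mul1mx.
rewrite -[M]/N NE -[c]add0r -[0](mul0mx _ (E 1 *m N)).
apply: scales_volume_comp.
  rewrite -[0]row_mx0; apply: scales_volume_block_ur => c'; apply: IH.
  exact: unitmx1.
apply: scales_nz; first by rewrite unitmx_mul uE.
rewrite -[N]submxK mulmx_block block_mxKul ul0 mulmx0 add0r scale1r mxE.
apply: contra d0; rewrite psumr_eq0 => [|i _]; last first.
  by rewrite mxE -expr2 sqr_ge0.
move/allP => d0; apply/eqP/matrixP => i j; rewrite ord1 [RHS]mxE.
by have := d0 i (mem_index_enum _); rewrite mxE mulf_eq0 orbb => /eqP.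
Qed.

End volume_affine.

(** * From Borel sets to Lebesgue-measurable sets *)

Section outer_measure_isomorphism.
Local Open Scope ereal_scope.
Variables (d : measure_display) (T : measurableType d) (R : realType).
Variable m : {measure set T -> \bar R}.

(** The preimage of a cover of [A] is a cover of the preimage of [A]. *)
Lemma le_mu_ext_preimage (f : T -> T) :
  measurable_fun [set: T] f ->
  (forall A, measurable A -> m (f @^-1` A) = m A) ->
  forall A, mu_ext m (f @^-1` A) <= mu_ext m A.
Proof.
move=> mf fm A; apply: ereal_inf_le_tmp => _ [F [mF AF] <-].
exists (fun k => f @^-1` (F k)); last by apply: eq_eseriesr => k _; rewrite fm.
split=> [k|]; first by rewrite -[X in measurable X]setTI; exact: mf.
by rewrite -preimage_bigcup; exact: preimage_subset.
Qed.

Variables f g : T -> T.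
Hypotheses (mf : measurable_fun [set: T] f) (mg : measurable_fun [set: T] g).
Hypotheses (fK : cancel f g) (gK : cancel g f).
Hypothesis fm : forall A, measurable A -> m (f @^-1` A) = m A.

Let preimageK A : f @^-1` (g @^-1` A) = A.
Proof. by apply/funext => x; rewrite /preimage/= fK. Qed.

Lemma mu_ext_preimage A : mu_ext m (f @^-1` A) = mu_ext m A.
Proof.
apply/eqP; rewrite eq_le le_mu_ext_preimage//=.
have gm B : measurable B -> m (g @^-1` B) = m B.
  move=> mB; rewrite -[LHS]fm ?preimageK//.
  by rewrite -[X in measurable X]setTI; exact: mg.
apply: le_trans (le_mu_ext_preimage mg gm _).
by rewrite -comp_preimage (_ : f \o g = id) ?preimage_id//; exact/funext.
Qed.

Lemma caratheodory_preimage A :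
  (mu_ext m).-caratheodory A -> (mu_ext m).-caratheodory (f @^-1` A).
Proof.
move=> cA X; rewrite -[X]preimageK mu_ext_preimage cA.
by rewrite [~` (f @^-1` A)]preimage_setC -!preimage_setI !mu_ext_preimage.
Qed.

End outer_measure_isomorphism.

Section lebesgue_linear.
Variables (R : realType) (n : nat) (M : 'M[R]_n).
Hypothesis detM : `|\det M| = 1.
Local Notation Ln := (lebesgue_rV R n).
Local Notation mulM := (fun v : Ln => (v : 'rV[R]_n) *m M : Ln).

Lemma unitmx_norm_det1 : M \in unitmx.
Proof. by rewrite unitmxE unitfE -normr_eq0 detM oner_eq0. Qed.

Let uM := unitmx_norm_det1.
Let mulM_borel (N : 'M[R]_n) (v : borel_rV R n) : borel_rV R n :=
  (v : 'rV[R]_n) *m N.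

Let measurable_borel (N : 'M[R]_n) : measurable_fun setT (mulM_borel N).
Proof.
rewrite (_ : mulM_borel N = affine_rV N 0); first exact: measurable_affine_rV.
by apply/funext => v; rewrite /affine_rV addr0.
Qed.

Let volume_borel A : measurable A ->
  volume R n (mulM_borel M @^-1` A) = volume R n A.
Proof.
move=> mA; rewrite -[RHS](det_scales_volume 0 uM)// detM mul1e.
by congr (volume R n _); apply/funext => v; rewrite /preimage /affine_rV/= addr0.
Qed.

Let mulMK : cancel (mulM_borel M) (mulM_borel (invmx M)).
Proof. by move=> v; exact: mulmxK. Qed.

Let mulMVK : cancel (mulM_borel (invmx M)) (mulM_borel M).
Proof. by move=> v; exact: mulmxKV. Qed.

Lemma lebesgue_measurable_mulmx : measurable_fun [set: Ln] mulM.
Proof.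
move=> _ A mA; rewrite setTI.
exact: (caratheodory_preimage (measurable_borel M)
  (measurable_borel (invmx M)) mulMK mulMVK volume_borel mA).
Qed.

Lemma lebesgue_mulmx (A : set Ln) : lebesgue (mulM @^-1` A) = lebesgue A.
Proof.
exact: (mu_ext_preimage (measurable_borel M)
  (measurable_borel (invmx M)) mulMK mulMVK volume_borel).
Qed.

End lebesgue_linear.

Section integral_lebesgue_mulmx.
Variables (R : realType) (n : nat) (M : 'M[R]_n).
Hypothesis detM : `|\det M| = 1.
Local Notation Ln := (lebesgue_rV R n).

Lemma norm_det_invmx : `|\det (invmx M)| = 1.
Proof. by rewrite det_inv normfV detM invr1. Qed.

Lemma integral_lebesgue_mulmx (D : set Ln) (h : 'rV[R]_n -> \bar R) :
  (\int[@lebesgue R n]_(x in D) h x =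
   \int[@lebesgue R n]_(x in [set x | D (x *m M)]) h (x *m M))%E.
Proof.
apply: (integral_measure_iso (lebesgue_measurable_mulmx detM)
  (lebesgue_measurable_mulmx norm_det_invmx)) => [v|v|A _].
- by apply: mulmxK; exact: unitmx_norm_det1.
- by apply: mulmxKV; exact: unitmx_norm_det1.
- exact: lebesgue_mulmx.
Qed.

End integral_lebesgue_mulmx.

(** * Equivariance of the functional constructions *)

Section linear_invariance.
Variables (R : realType) (n : nat).
Local Notation Rn := 'rV[R]_n.
Local Notation Ln := (lebesgue_rV R n).
Implicit Types (M : 'M[R]_n) (p q : Rn -> R).

Lemma mu_mulmx M p : `|\det M| = 1 -> mu (fun x => p (x *m M)) = mu p.
Proof. by move=> detM; exact/esym/(integral_lebesgue_mulmx detM setT). Qed.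

Lemma dotp_mulmxl M (x y : Rn) : dotp (x *m M) y = dotp x (y *m M^T).
Proof.
have dotpE (u v : Rn) : dotp u v = (u *m v^T) ord0 ord0.
  by rewrite mxE; apply: eq_bigr => i _; rewrite mxE.
by rewrite !dotpE trmx_mul trmxK mulmxA.
Qed.

(** Substituting [z = x *m M] in the infimum moves [M^-1] to the other side of
    the inner product. *)
Lemma polar_mulmx M p y : M \in unitmx ->
  polar (fun x => p (x *m M)) y = polar p (y *m (invmx M)^T).
Proof.
move=> uM; congr inf; apply/seteqP; split=> [_ [x _ <-]|_ [z _ <-]].
  by exists (x *m M) => //; rewrite -dotp_mulmxl mulmxK.
by exists (z *m invmx M) => //; rewrite dotp_mulmxl mulmxKV.
Qed.

Lemma mu_polar_mulmx M p : `|\det M| = 1 ->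
  mu (polar (fun x => p (x *m M))) = mu (polar p).
Proof.
move=> detM; rewrite -[RHS](@mu_mulmx (invmx M)^T); last first.
  by rewrite det_tr norm_det_invmx.
congr mu; apply/funext => y; apply: polar_mulmx; exact: unitmx_norm_det1.
Qed.

Lemma Fplus_mulmx M p : `|\det M| = 1 -> Fplus p ->
  Fplus (fun x => p (x *m M)).
Proof.
move=> detM [mp p0]; split => [|x]; last exact: p0.
exact: (measurableT_comp mp (lebesgue_measurable_mulmx detM)).
Qed.

Lemma Dset_mulmx M p : `|\det M| = 1 -> Dset p -> Dset (fun x => p (x *m M)).
Proof.
move=> detM [Fp mup]; split; first exact: Fplus_mulmx.
by rewrite mu_mulmx// mu_polar_mulmx.
Qed.

Lemma log_concave_mulmx M p : log_concave p ->
  log_concave (fun x => p (x *m M)).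
Proof.
move=> [psi psi_convex pE]; exists (fun x => psi ((x : Rn) *m M)) => [|x].
  move=> t x y _ _; have := psi_convex t (x *m M) (y *m M).
  rewrite !in_setT => /(_ isT isT); congr (_ <= _).
  congr psi; apply: esym (etrans (mulmxDl _ _ _) _).
  by rewrite -!scalemxAl.
by rewrite pE.
Qed.

Lemma has_density_mulmx M (P Q : {finite_measure set Ln -> \bar R}) p :
  `|\det M| = 1 -> has_density P p ->
  (forall A : set Ln, measurable A -> Q A = P [set x | A (x *m invmx M)]) ->
  has_density Q (fun x => p (x *m M)).
Proof.
move=> detM [Fp pP] QE; split => [|A mA]; first exact: Fplus_mulmx.
rewrite QE// pP; last first.
  have := lebesgue_measurable_mulmx (norm_det_invmx detM).
  by move=> /(_ measurableT _ mA); rewrite setTI.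
rewrite (integral_lebesgue_mulmx detM); congr integral.
by apply/funext => x /=; rewrite mulmxK// unitmx_norm_det1.
Qed.

(** [Q] is pinned down by one density, so that any other density of [P] also
    transports to [Q]; the divergences range over all of them. *)
Lemma has_density_mulmxE M (P Q : {finite_measure set Ln -> \bar R}) p :
  `|\det M| = 1 -> has_density P p -> has_density Q (fun x => p (x *m M)) ->
  forall A : set Ln, measurable A -> Q A = P [set x | A (x *m invmx M)].
Proof.
move=> detM [_ pP] [_ pQ] A mA; rewrite pQ// pP; last first.
  have := lebesgue_measurable_mulmx (norm_det_invmx detM).
  by move=> /(_ measurableT _ mA); rewrite setTI.
rewrite [RHS](integral_lebesgue_mulmx detM); congr integral.
by apply/funext => x /=; rewrite mulmxK// unitmx_norm_det1.
Qed.

(** The measure is the image of [P] under [M^-1]. *)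
Lemma has_density_mulmx_exists M (P : {finite_measure set Ln -> \bar R}) p :
  `|\det M| = 1 -> has_density P p ->
  exists Q : {finite_measure set Ln -> \bar R},
    has_density Q (fun x => p (x *m M)).
Proof.
move=> detM pP.
pose f (v : Ln) : Ln := (v : Rn) *m invmx M.
have mf : measurable_fun setT f.
  exact: lebesgue_measurable_mulmx (norm_det_invmx detM).
unshelve refine (let PM : {measure set Ln -> \bar R} := pushforward P f in _).
  exact: mf.
have PMoo : (PM setT < +oo)%E.
  rewrite -ge0_fin_numE ?measure_ge0//.
  exact: (fin_num_measure P _ measurableT).
(* Restricting to the whole space packages [PM] as a finite measure. *)
exists (mfrestr measurableT PMoo).
apply: (has_density_mulmx detM pP) => A _.
by rewrite /= /mfrestr /mrestr setIT.
Qed.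

Lemma divergences_mulmx_sub M phi (C : set (Rn -> R))
    (P Q : {finite_measure set Ln -> \bar R}) :
  `|\det M| = 1 ->
  (forall q, C q -> C (fun x => q (x *m M))) ->
  (forall A : set Ln, measurable A -> Q A = P [set x | A (x *m invmx M)]) ->
  divergences phi C P `<=` divergences phi C Q.
Proof.
move=> detM CM QE _ [p [q [S [pP qS Cq ->]]]].
have [SM qSM] := has_density_mulmx_exists detM qS.
exists (fun x => p (x *m M)), (fun x => q (x *m M)), SM; split=> //.
- exact: has_density_mulmx QE.
- exact: CM.
- by rewrite mu_polar_mulmx//; exact: (integral_lebesgue_mulmx detM setT).
Qed.

(** Stated for any class [C] stable under unimodular maps, so as to cover both
    surface areas. *)
Lemma orlicz_extremum_mulmx M phi (C : set (Rn -> R))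
    (P Q : {finite_measure set Ln -> \bar R}) p :
  `|\det M| = 1 ->
  (forall N q, `|\det N| = 1 -> C q -> C (fun x => q (x *m N))) ->
  has_density P p -> has_density Q (fun x => p (x *m M)) ->
  orlicz_extremum phi C Q = orlicz_extremum phi C P.
Proof.
move=> detM CM pP pQ.
suff div : divergences phi C Q = divergences phi C P.
  by rewrite /orlicz_extremum div.
apply/seteqP; split; last first.
  apply: (divergences_mulmx_sub detM) (has_density_mulmxE detM pP pQ) => q.
  exact: CM.
have detV := norm_det_invmx detM.
apply: (divergences_mulmx_sub detV) => [q|]; first exact: CM.
apply: (has_density_mulmxE detV pQ); rewrite (_ : (fun x => _) = p)//.
by apply/funext => x; rewrite mulmxKV// unitmx_norm_det1.
Qed.

End linear_invariance.

Theorem theorem13 (R : realType) (n : nat) (phi : R -> R)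
    (hphi : Phi phi \/ Psi phi)
    (T : {linear 'rV[R]_n -> 'rV[R]_n})
    (detT : \det (lin1_mx T) = 1 \/ \det (lin1_mx T) = -1)
    (P : {finite_measure set (lebesgue_rV R n) -> \bar R}) (p : 'rV[R]_n -> R)
    (hP : has_density P p) :
  (exists PT : {finite_measure set (lebesgue_rV R n) -> \bar R},
     has_density PT (p \o T)) /\
  (forall PT : {finite_measure set (lebesgue_rV R n) -> \bar R},
     has_density PT (p \o T) ->
     dual_affine_surface_area phi PT = dual_affine_surface_area phi P /\
     dual_geominimal_surface_area phi PT = dual_geominimal_surface_area phi P).
Proof.
have detM : `|\det (lin1_mx T)| = 1.
  by case: detT => ->; rewrite ?normrN normr1.
have -> : p \o T = fun x => p (x *m lin1_mx T).
  by apply/funext => x; rewrite mul_rV_lin1.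
split=> [|PT hPT]; first exact: has_density_mulmx_exists detM hP.
split; apply: (orlicz_extremum_mulmx _ detM _ hP hPT) => N q detN.
  exact: Dset_mulmx.
by move=> [Dq lq]; split; [exact: Dset_mulmx|exact: log_concave_mulmx].
Qed.
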